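(* Let $R_0=0.35320\ldots$ be the positive root of the equation $R^3+2R^2+2R-1=0$. For every $n\in\mathbb{N}$, all complex roots of the Fibonacci polynomials $\mathcal{F}_n(q)$ and $\tilde{\mathcal{F}}_n(q)$ belong to the annulus $$R_0<|q|<R_0^{-1}.$$
   Context: Here $\mathbb{N}=\{1,2,3,\ldots\}$. For an integer $c\ge 1$ let $[c]_q = 1+q+\cdots+q^{c-1}$. Every rational $x>0$ has a unique finite Hirzebruch-Jung continued fraction expansion $$x=\llbracket c_1,\ldots,c_N\rrbracket := c_1-\cfrac{1}{c_2-\cfrac{1}{\ddots-\cfrac{1}{c_N}}},$$ with integers $c_1\ge 1$ and $c_j\ge 2$ for $j\ge 2$. The $q$-deformation of $x$ is the rational function $$[x]_q := [c_1]_q-\cfrac{q^{c_1-1}}{[c_2]_q-\cfrac{q^{c_2-1}}{\ddots-\cfrac{q^{c_{N-1}-1}}{[c_N]_q}}}.$$ It is written uniquely as $[x]_q=\mathcal{R}(q)/\mathcal{S}(q)$ with $\mathcal{R},\mathcal{S}\in\mathbb{Z}[q]$ coprime polynomials with nonnegative integer coefficients. Let $F_n$ be the Fibonacci numbers, indexed so that $F_0=F_1=1$ and $F_{n+1}=F_n+F_{n-1}$ (so $F_2=2$, $F_3=3$, $F_4=5$, ...). The Fibonacci polynomials $\mathcal{F}_n(q)$ ($n\ge 0$) and $\tilde{\mathcal{F}}_{n+1}(q)$ ($n\ge 0$) are the denominator $\mathcal{S}(q)$ and numerator $\mathcal{R}(q)$ when $[x]_q$, for $x=F_{n+1}/F_n$,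 is written as a quotient $\mathcal{R}(q)/\mathcal{S}(q)$ of coprime polynomials in $\mathbb{Z}[q]$ with nonnegative integer coefficients, that is, $$\left[\frac{F_{n+1}}{F_n}\right]_q=\frac{\tilde{\mathcal{F}}_{n+1}(q)}{\mathcal{F}_n(q)}.$$ *)

(* Defs.v *)
From mathcomp Require Import all_boot all_order all_algebra.
From mathcomp Require Import all_real_closed.
From mathcomp Require Import boolp classical_sets reals.
From mathcomp Require Import zify ring lra.

Set Implicit Arguments.
Unset Strict Implicit.
Unset Printing Implicit Defensive.

Import Order.TTheory GRing.Theory Num.Theory.

Local Open Scope ring_scope.

Definition hj_admissible (c : seq nat) : bool :=
  if c is c1 :: c' then (1 <= c1)%N && all (leq 2) c' else false.

Fixpoint hj_value (c : seq nat) : rat :=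
  match c with
  | [::] => 0
  | [:: c1] => c1%:R
  | c1 :: c' => c1%:R - (hj_value c')^-1
  end.

Definition is_hj_expansion (x : rat) (c : seq nat) : Prop :=
  hj_admissible c /\ hj_value c = x.

(* The default [::] is only taken for x <= 0: see hj_expansion_exists and
   hj_expansion_unique below. *)
Definition hj_expansion (x : rat) : seq nat :=
  xget [::] [set c | is_hj_expansion x c]%classic.

Definition qint (c : nat) : {poly int} := \sum_(i < c) 'X^i.

Fixpoint hj_qvalue (c : seq nat) : {fraction {poly int}} :=
  match c with
  | [::] => 0
  | [:: c1] => tofrac (qint c1)
  | c1 :: c' => tofrac (qint c1) - tofrac 'X^(c1 - 1) / hj_qvalue c'
  end.

Definition qrat (x : rat) : {fraction {poly int}} := hj_qvalue (hj_expansion x).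

(* Coprimality in the ring Z[q] itself.  The library's coprimep is not used:
   on {poly int} it is defined by pseudo-division, hence ignores common
   integer factors. *)
Definition coprime_polyZ (p r : {poly int}) : Prop :=
  forall d : {poly int},
    (exists a, p = a * d) -> (exists b, r = b * d) -> d \is a GRing.unit.

Definition nonneg_coefs (p : {poly int}) : Prop := forall i : nat, 0 <= p`_i.

(* The pair RS is (numerator, denominator). *)
Definition is_reduced_quotient (f : {fraction {poly int}})
    (RS : {poly int} * {poly int}) : Prop :=
  [/\ RS.2 != 0, f = tofrac RS.1 / tofrac RS.2, coprime_polyZ RS.1 RS.2,
      nonneg_coefs RS.1 & nonneg_coefs RS.2].

(* The default (0, 0) is never taken for x > 0: see qrat_quotient_exists and
   qrat_quotient_unique below. *)
Definition qrat_quotient (x : rat) : {poly int} * {poly int} :=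
  xget (0, 0) [set RS | is_reduced_quotient (qrat x) RS]%classic.

Definition qnum (x : rat) : {poly int} := (qrat_quotient x).1.
Definition qden (x : rat) : {poly int} := (qrat_quotient x).2.

(* Indexed so that fib 0 = fib 1 = 1. *)
Fixpoint fib (n : nat) : nat :=
  match n with
  | 0 => 1
  | m.+1 => if m is k.+1 then (fib m + fib k)%N else 1%N
  end.

Definition fib_ratio (n : nat) : rat := (fib n.+1)%:R / (fib n)%:R.

Definition fib_poly (n : nat) : {poly int} := qden (fib_ratio n).

(* The numerator at fib n.+1 / fib n has index n.+1; the value at n = 0 is
   meaningless. *)
Definition fib_poly_tilde (n : nat) : {poly int} := qnum (fib_ratio n.-1).

Lemma hj_value_cons (c1 : nat) (c : seq nat) :
  c != [::] -> hj_value (c1 :: c) = c1%:R - (hj_value c)^-1.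
Proof. by case: c. Qed.

Lemma hj_qvalue_cons (c1 : nat) (c : seq nat) :
  c != [::] ->
  hj_qvalue (c1 :: c) =
    tofrac (qint c1) - tofrac 'X^(c1 - 1) / hj_qvalue c.
Proof. by case: c. Qed.

#[local] Arguments hj_value : simpl never.
#[local] Arguments hj_qvalue : simpl never.

Lemma hj_value_gt1 (c : seq nat) :
  c != [::] -> all (leq 2) c -> 1 < hj_value c.
Proof.
elim: c => // c1 c IH _ /andP[h1 hc].
have c2 : (2 : rat) <= c1%:R by rewrite ler_nat.
have [->|cn0] := eqVneq c [::]; first by rewrite /hj_value; lra.
have := IH cn0 hc; rewrite hj_value_cons // => v1.
have : (hj_value c)^-1 < 1 by rewrite invf_lt1 // (lt_trans _ v1).
by lra.
Qed.

Lemma hj_value_bounds (c1 : nat) (c : seq nat) :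
  all (leq 2) c ->
  c1%:R - 1 < hj_value (c1 :: c) /\
  (if c == [::] then hj_value (c1 :: c) = c1%:R
   else hj_value (c1 :: c) < c1%:R).
Proof.
move=> hc; have [->|cn0] := eqVneq c [::]; first by rewrite /hj_value; split => //; lra.
have v1 := hj_value_gt1 cn0 hc; rewrite hj_value_cons //.
have v0 : 0 < hj_value c by lra.
have : (hj_value c)^-1 < 1 by rewrite invf_lt1.
have : 0 < (hj_value c)^-1 by rewrite invr_gt0.
by split; lra.
Qed.

Lemma hj_expansion_exists (x : rat) : 0 < x -> exists c, is_hj_expansion x c.
Proof.
have main (d : nat) : forall p : nat, (0 < d)%N -> (0 < p)%N ->
    exists c, [/\ hj_admissible c, hj_value c = p%:R / d%:R
                & (d < p)%N -> all (leq 2) c].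
  elim/ltn_ind: d => d IH p d0 p0.
  pose c1 := ((p + d.-1) %/ d)%N; pose r := (c1 * d - p)%N.
  have e := divn_eq (p + d.-1) d; rewrite -/c1 in e.
  have m := ltn_pmod (p + d.-1) d0.
  have e1 : (c1 * d = p + r)%N by rewrite /r; lia.
  have rd : (r < d)%N by rewrite /r; lia.
  have c10 : (0 < c1)%N by case: (c1) e1 => //=; lia.
  have c12 : (d < p)%N -> (2 <= c1)%N.
    by move=> dp; case: (c1) c10 e1 => [//|[|//]] _; lia.
  have dn0 : d%:R != 0 :> rat by rewrite pnatr_eq0 -lt0n.
  have eR : c1%:R * d%:R = p%:R + r%:R :> rat by rewrite -natrM e1 natrD.
  have [r0|r0] := posnP r.
    exists [:: c1]; rewrite /hj_value; split=> /=; first by rewrite c10.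
      by apply: (mulIf dn0); rewrite eR r0 mulfVK // addr0.
    by move=> /c12 ->.
  have [c [ac vc hc]] := IH r rd d r0 d0.
  have cn0 : c != [::] by case: (c) ac.
  have rn0 : r%:R != 0 :> rat by rewrite pnatr_eq0 -lt0n.
  exists (c1 :: c); split=> /=; first by rewrite c10 hc.
    rewrite hj_value_cons // vc invf_div.
    have -> : c1%:R = (p%:R + r%:R) / d%:R :> rat by rewrite -eR mulfK.
    by rewrite -mulrBl addrK.
  by move=> /c12 ->; rewrite hc.
move=> x0; have n0 : 0 < numq x by rewrite numq_gt0.
have d0 := denq_gt0 x.
have [||c [ac vc _]] := main `|denq x|%N `|numq x|%N.
- by rewrite absz_gt0 gt_eqF.
- by rewrite absz_gt0 gt_eqF.
exists c; split=> //; rewrite vc -[RHS]divq_num_den.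
by rewrite !natr_absz !gtr0_norm.
Qed.

Lemma hj_expansion_unique (x : rat) (c d : seq nat) :
  is_hj_expansion x c -> is_hj_expansion x d -> c = d.
Proof.
move=> [ac <-] [ad]; elim: c d ac ad => [|c1 c IH] [|d1 d] //=.
move=> /andP[h1 hc] /andP[h1' hd] e.
have [lc uc] := hj_value_bounds c1 hc; have [ld ud] := hj_value_bounds d1 hd.
have {uc} uc : hj_value (c1 :: c) <= c1%:R by case: eqP uc => _; lra.
have {ud} ud : hj_value (d1 :: d) <= d1%:R by case: eqP ud => _; lra.
have e1 : c1 = d1.
  have h : c1%:R < (d1.+1)%:R :> rat by rewrite -natr1; lra.
  have h' : d1%:R < (c1.+1)%:R :> rat by rewrite -natr1; lra.
  by move: h h'; rewrite !ltr_nat; lia.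
subst d1; congr cons.
have [_ uc'] := hj_value_bounds c1 hc; have [_ ud'] := hj_value_bounds c1 hd.
have [c0|cn0] := eqVneq c [::]; have [d0|dn0] := eqVneq d [::].
- by rewrite c0 d0.
- by subst c; move: uc' ud'; rewrite (negPf dn0) eqxx /= => h h'; exfalso; lra.
- by subst d; move: uc' ud'; rewrite (negPf cn0) eqxx /= => h h'; exfalso; lra.
have ad2 (s : seq nat) : s != [::] -> all (leq 2) s -> hj_admissible s.
  by case: s => //= s1 s _ /andP[h ->]; rewrite andbT ltnW.
apply: IH; [exact: ad2| exact: ad2|].
move: e; rewrite !hj_value_cons //.
by move=> /addrI /oppr_inj /invr_inj.
Qed.

Lemma hj_expansionP (x : rat) : 0 < x -> is_hj_expansion x (hj_expansion x).
Proof. by move=> /hj_expansion_exists[c hc]; exact: (xgetI [::] hc). Qed.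

Lemma qint_rec (c : nat) : qint c.+1 = 1 + 'X * qint c.
Proof.
rewrite /qint big_ord_recl expr0 mulr_sumr; congr (_ + _).
by apply: eq_bigr => i _; rewrite -exprS.
Qed.

Lemma qint_recr (c : nat) : qint c.+1 = qint c + 'X^c.
Proof. by rewrite /qint big_ord_recr. Qed.

Lemma nonneg_coefsD (p r : {poly int}) :
  nonneg_coefs p -> nonneg_coefs r -> nonneg_coefs (p + r).
Proof. by move=> hp hr i; rewrite coefD addr_ge0. Qed.

Lemma nonneg_coefsM (p r : {poly int}) :
  nonneg_coefs p -> nonneg_coefs r -> nonneg_coefs (p * r).
Proof.
by move=> hp hr i; rewrite coefM; apply: sumr_ge0 => j _; rewrite mulr_ge0.
Qed.

Lemma nonneg_coefsXn (k : nat) : nonneg_coefs 'X^k.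
Proof. by move=> i; rewrite coefXn; case: eqP. Qed.

Lemma nonneg_coefs_qint (c : nat) : nonneg_coefs (qint c).
Proof.
elim: c => [|c IH]; first by move=> i; rewrite /qint big_ord0 coef0.
by rewrite qint_recr; apply: nonneg_coefsD => //; exact: nonneg_coefsXn.
Qed.

Lemma dvd_Xn_mul (k : nat) (d p : {poly int}) :
  d`_0 != 0 -> (exists a, 'X^k * p = a * d) -> exists a, p = a * d.
Proof.
move=> d0; elim: k => [|k IH] [a e]; first by exists a; rewrite -e mul1r.
have a0 : a`_0 = 0.
  have /eqP : (a * d)`_0 = 0 by rewrite -e exprS -mulrA coefXM.
  by rewrite coef0M mulf_eq0 (negPf d0) orbF => /eqP.
have : root a 0 by rewrite /root horner_coef0 a0.
move=> /factor_theorem[b]; rewrite subr0 => eb; apply: IH; exists b.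
by apply: (mulfI (monic_neq0 (monicX int))); rewrite mulrA -exprS e eb; ring.
Qed.

(* The relation a R + b S = 'X^k, together with S`_0 = 1, gives coprimality
   in Z[q] and survives each step of the continued fraction. *)
Lemma hj_qvalue_quotient (c : seq nat) : hj_admissible c ->
  exists R S a b : {poly int}, exists k : nat,
    [/\ hj_qvalue c = tofrac R / tofrac S, S`_0 = 1,
        a * R + b * S = 'X^k, nonneg_coefs R & nonneg_coefs S].
Proof.
have main (s : seq nat) : s != [::] -> all (leq 2) s ->
  exists R S a b : {poly int}, exists k : nat,
    [/\ hj_qvalue s = tofrac R / tofrac S /\ S`_0 = 1,
        a * R + b * S = 'X^k, nonneg_coefs R, nonneg_coefs S &
        R`_0 = 1 /\ nonneg_coefs (R - S)].
  elim: s => // -[|[|c1]] //= s IH _ hs.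
  have [-> /=|sn0] := eqVneq s [::].
    exists (qint c1.+2), 1, 0, 1, 0%N; split.
    - by rewrite /hj_qvalue tofrac1 divr1 coef1.
    - by rewrite mul0r add0r mulr1 expr0.
    - exact: nonneg_coefs_qint.
    - exact: (nonneg_coefsXn 0).
    split; first by rewrite qint_rec coefD coefXM coef1 /= addr0.
    rewrite qint_rec addrAC subrr add0r.
    apply: nonneg_coefsM; last exact: nonneg_coefs_qint.
    exact: (nonneg_coefsXn 1).
  have [R [S [a [b [k [[e S0] ab hR hS [R0 hRS]]]]]]] := IH sn0 hs.
  have Rn0 : R != 0 by apply: contra_eq_neq R0 => ->; rewrite coef0.
  exists (qint c1.+2 * R - 'X^(c1.+1) * S), R,
    (- b), (a * 'X^(c1.+1) + b * qint c1.+2), (k + c1.+1)%N; split.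
  - split=> //; rewrite hj_qvalue_cons // e subn1 /=.
    have : tofrac R != 0 by rewrite tofrac_eq0.
    rewrite tofracB !tofracM => Rn; rewrite mulrBl mulfK // invf_div.
    by rewrite mulrA.
  - by rewrite exprD -ab; ring.
  - have -> : qint c1.+2 * R - 'X^(c1.+1) * S =
              qint c1.+1 * R + 'X^(c1.+1) * (R - S).
      by rewrite qint_recr; ring.
    apply: nonneg_coefsD; apply: nonneg_coefsM => //.
      exact: nonneg_coefs_qint.
    exact: nonneg_coefsXn.
  - exact: hR.
  split.
    rewrite coefB coef0M R0 coef0M coefXn /= mul0r subr0 mulr1.
    by rewrite qint_rec coefD coefXM coef1 /= addr0.
  have -> : qint c1.+2 * R - 'X^(c1.+1) * S - R =
            'X^1 * qint c1 * R + 'X^(c1.+1) * (R - S).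
    by rewrite qint_rec qint_recr expr1 exprS; ring.
  apply: nonneg_coefsD; apply: nonneg_coefsM => //.
    apply: nonneg_coefsM; [exact: nonneg_coefsXn|exact: nonneg_coefs_qint].
  exact: nonneg_coefsXn.
case: c => [//|[//|c1] s] /= hs.
have [->|sn0] := eqVneq s [::].
  exists (qint c1.+1), 1, 0, 1, 0%N; split.
  - by rewrite /hj_qvalue tofrac1 divr1.
  - by rewrite coef1.
  - by rewrite mul0r add0r mulr1 expr0.
  - exact: nonneg_coefs_qint.
  - exact: (nonneg_coefsXn 0).
have [R [S [a [b [k [[e S0] ab hR hS [R0 hRS]]]]]]] := main s sn0 hs.
have Rn0 : R != 0 by apply: contra_eq_neq R0 => ->; rewrite coef0.
exists (qint c1.+1 * R - 'X^c1 * S), R,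
  (- b), (a * 'X^c1 + b * qint c1.+1), (k + c1)%N; split=> //.
- rewrite hj_qvalue_cons // e subn1 /=.
  have : tofrac R != 0 by rewrite tofrac_eq0.
  rewrite tofracB !tofracM => Rn; rewrite mulrBl mulfK // invf_div.
  by rewrite mulrA.
- by rewrite exprD -ab; ring.
have -> : qint c1.+1 * R - 'X^c1 * S = qint c1 * R + 'X^c1 * (R - S).
  by rewrite qint_recr; ring.
apply: nonneg_coefsD; apply: nonneg_coefsM => //.
  exact: nonneg_coefs_qint.
exact: nonneg_coefsXn.
Qed.

Lemma polyZ_unit1 (d : {poly int}) :
  d \is a GRing.unit -> d = 1 \/ d = -1.
Proof.
rewrite poly_unitE => /andP[/size_poly1P[u _ ->]].
rewrite coefC /= => /orP[] /eqP ->; [by left|right].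
by rewrite polyCN.
Qed.

Lemma qrat_quotient_exists (x : rat) :
  0 < x -> exists RS, is_reduced_quotient (qrat x) RS.
Proof.
move=> /hj_expansionP[/hj_qvalue_quotient].
move=> [R [S [a [b [k [e S0 ab hR hS]]]]]] _; exists (R, S); split=> //=.
  by apply: contra_eq_neq S0 => ->; rewrite coef0.
move=> d [r er] [s es].
have d0 : d`_0 != 0.
  by apply: contra_eq_neq S0 => d0; rewrite es coef0M d0 mulr0.
have [|u eu] := dvd_Xn_mul (k := k) (p := 1) d0.
  by exists (a * r + b * s); rewrite mulr1 -ab er es; ring.
by apply/unitrPr; exists u; rewrite mulrC.
Qed.

Lemma qrat_quotient_unique (x : rat) (RS RS' : {poly int} * {poly int}) :
  0 < x -> is_reduced_quotient (qrat x) RS ->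
  is_reduced_quotient (qrat x) RS' -> RS = RS'.
Proof.
move=> x0; have [/hj_qvalue_quotient] := hj_expansionP x0.
move=> [R [S [a [b [k [e S0 ab hR hS]]]]]] _.
have Sn0 : S != 0 by apply: contra_eq_neq S0 => ->; rewrite coef0.
suff main P : is_reduced_quotient (qrat x) P -> P = (R, S).
  by move=> /main -> /main ->.
case: P => [R' S'] [/= Sn0' e' cop hR' hS'].
have eq1 : R * S' = R' * S.
  apply/eqP; rewrite -tofrac_eq !tofracM.
  by rewrite -eqr_div ?tofrac_eq0 // -e -e' ?eqxx.
have S0' : S`_0 != 0 by rewrite S0.
have [|t et] := dvd_Xn_mul (k := k) (p := S') S0'.
  exists (a * R' + b * S'); rewrite -ab.
  have -> : (a * R + b * S) * S' = a * (R * S') + b * S * S' by ring.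
  by rewrite eq1; ring.
have et' : R' = R * t.
  by apply: (mulIf Sn0); rewrite -eq1 et; ring.
have [|t1|t1] := @polyZ_unit1 t; first apply: cop.
- by exists R.
- by exists S; rewrite et mulrC.
- by rewrite et et' t1 mulr1 mul1r.
- by have := hS' 0%N; rewrite et t1 mulN1r coefN S0.
Qed.

(* Main.v *)
(** The continued fraction of [fib n.+1 / fib n] is [2, 3, ..., 3] or
    [2, 3, ..., 3, 2], so the numerators and the denominators, taken two steps
    apart, satisfy a(k+2) = (1 + q + q^2) a(k+1) - q^2 a(k).  As soon as
    2 |q| < |1 + q + q^2|, the inequality |q| |a(k)| < |a(k+1)| propagates along
    this recurrence, so no a(k) vanishes at q.  The condition on q holds when
    |q| <= 9/25 or |q| >= 25/9, and R0 < 9/25. *)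
Require Import Defs.
From mathcomp Require Import all_boot all_order all_algebra.
From mathcomp Require Import all_real_closed.
From mathcomp Require Import boolp classical_sets reals.
From mathcomp Require Import zify ring lra.

Set Implicit Arguments.
Unset Strict Implicit.
Unset Printing Implicit Defensive.

Import Order.TTheory GRing.Theory Num.Theory.
Import ComplexField.Normc.

Local Open Scope ring_scope.
Local Open Scope complex_scope.

(** * Continued fractions of ratios of Fibonacci numbers *)

Lemma fibSS (n : nat) : fib n.+2 = (fib n.+1 + fib n)%N.
Proof. by []. Qed.

Lemma fib_gt0 (n : nat) : (0 < fib n)%N.
Proof.
suff /andP[] : (0 < fib n)%N && (0 < fib n.+1)%N by [].
elim: n => [//|n /andP[h h1]]; rewrite h1 fibSS.
by rewrite addn_gt0 h1.
Qed.

Lemma fib_ratio_gt0 (n : nat) : 0 < fib_ratio n.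
Proof. by rewrite divr_gt0 // ltr0n fib_gt0. Qed.

(** The index, not the length, is the argument: [hj_tail n.+1] expands [fib n.+2 / fib n], and the
    parity decides whether the last digit is 2 or 3. *)
Fixpoint hj_tail (n : nat) : seq nat :=
  match n with
  | 0 => [::]
  | 1 => [:: 2%N]
  | m.+2 => 3%N :: hj_tail m
  end.

Lemma all_hj_tail (n : nat) : all (leq 2) (hj_tail n).
Proof.
suff /andP[] : all (leq 2) (hj_tail n) && all (leq 2) (hj_tail n.+1) by [].
by elim: n => // n /andP[h h1] /=; rewrite h1.
Qed.

Lemma hj_tail_neq0 (n : nat) : hj_tail n.+1 != [::].
Proof. by case: n. Qed.

Lemma hj_value_tail (n : nat) :
  hj_value (hj_tail n.+1) = (fib n.+2)%:R / (fib n)%:R.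
Proof.
suff [] : hj_value (hj_tail n.+1) = (fib n.+2)%:R / (fib n)%:R /\
          hj_value (hj_tail n.+2) = (fib n.+3)%:R / (fib n.+1)%:R by [].
elim: n => [|n [h h1]]; first by [].
split=> //; rewrite [hj_tail _]/= hj_value_cons ?hj_tail_neq0 // h invf_div.
have f2 : (fib n.+2)%:R != 0 :> rat by rewrite pnatr_eq0 -lt0n fib_gt0.
apply: (mulIf f2); rewrite mulrBl !divfK //.
by rewrite (fibSS n.+2) (fibSS n.+1) (fibSS n) !natrD; ring.
Qed.

Lemma hj_expansion_fib_ratio (n : nat) :
  hj_expansion (fib_ratio n.+1) = 2%N :: hj_tail n.
Proof.
apply: (@hj_expansion_unique (fib_ratio n.+1)).
  exact/hj_expansionP/fib_ratio_gt0.
split; first exact: all_hj_tail.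
case: n => [//|n]; rewrite hj_value_cons ?hj_tail_neq0 // hj_value_tail invf_div.
have f2 : (fib n.+2)%:R != 0 :> rat by rewrite pnatr_eq0 -lt0n fib_gt0.
apply: (mulIf f2); rewrite mulrBl !divfK //.
by rewrite (fibSS n.+1) (fibSS n) !natrD; ring.
Qed.

(** * Sequences with the three-term recurrence *)

Fixpoint qrec (T : pzRingType) (q a b c d : T) (n : nat) : T :=
  match n with
  | 0 => a
  | 1 => b
  | 2 => c
  | 3 => d
  | (m.+2 as k).+2 => (1 + q + q ^+ 2) * qrec q a b c d k
                      - q ^+ 2 * qrec q a b c d m
  end.

(** Two initial values for each parity of the index. The base ring is arbitrary so that one sequence
    serves both in Z[q], at ['X], and at a complex number. *)
Definition qfib_den (T : pzRingType) (q : T) : nat -> T :=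
  qrec q 1 1 (1 + q) (1 + q + q ^+ 2).

(* Indexed so that [qfib_num q n] is the numerator at [fib n.+1 / fib n]. *)
Definition qfib_num (T : pzRingType) (q : T) : nat -> T :=
  qrec q 1 (1 + q) (1 + q + q ^+ 2) (1 + q + 2 * q ^+ 2 + q ^+ 3).

Lemma qrecSSSS (T : pzRingType) (q a b c d : T) (n : nat) :
  qrec q a b c d n.+4 =
    (1 + q + q ^+ 2) * qrec q a b c d n.+2 - q ^+ 2 * qrec q a b c d n.
Proof. by []. Qed.

Lemma rmorph_qrec (T T' : pzRingType) (f : {rmorphism T -> T'})
    (q a b c d : T) (n : nat) :
  f (qrec q a b c d n) = qrec (f q) (f a) (f b) (f c) (f d) n.
Proof.
elim/ltn_ind: n => -[|[|[|[|n]]]] IH //.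
by rewrite !qrecSSSS rmorphB !rmorphM !rmorphD rmorph1 !rmorphXn !IH //; lia.
Qed.

Lemma rmorph_qfib_den (T T' : pzRingType) (f : {rmorphism T -> T'})
    (q : T) (n : nat) :
  f (qfib_den q n) = qfib_den (f q) n.
Proof. by rewrite /qfib_den rmorph_qrec !rmorphD rmorphXn rmorph1. Qed.

Lemma rmorph_qfib_num (T T' : pzRingType) (f : {rmorphism T -> T'})
    (q : T) (n : nat) :
  f (qfib_num q n) = qfib_num (f q) n.
Proof.
rewrite /qfib_num rmorph_qrec !rmorphD !rmorphXn rmorphM rmorphXn rmorph1.
by rewrite rmorph_nat.
Qed.

(** Both sides obey the recurrence, so the initial cases suffice. As [1 + q] is [2]_q, this accounts
    for the leading digit 2. *)
Lemma qfib_numE (T : comPzRingType) (q : T) (n : nat) :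
  qfib_num q n.+2 = (1 + q) * qfib_den q n.+2 - q * qfib_den q n.
Proof.
elim/ltn_ind: n => -[|[|[|[|n]]]] IH;
  try by rewrite /qfib_num /qfib_den /=; ring.
have := IH n ltac:(lia); have := IH n.+2 ltac:(lia).
rewrite /qfib_num /qfib_den => h2 h0.
rewrite (qrecSSSS _ _ _ _ _ n.+2) h0 h2.
rewrite (qrecSSSS _ _ _ _ _ n.+2) (qrecSSSS _ _ _ _ _ n); ring.
Qed.

(** * The q-deformed ratios as quotients of these sequences *)

Lemma qint2 : qint 2 = 1 + 'X.
Proof. by rewrite /qint !big_ord_recr big_ord0 /= add0r expr0 expr1. Qed.

Lemma qint3 : qint 3 = 1 + 'X + 'X^2.
Proof. by rewrite qint_recr qint2. Qed.

Lemma qrec_coef0 (a b c d : {poly int}) (n : nat) :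
  a`_0 = 1 -> b`_0 = 1 -> c`_0 = 1 -> d`_0 = 1 -> (qrec 'X a b c d n)`_0 = 1.
Proof.
move=> a0 b0 c0 d0; elim/ltn_ind: n => -[|[|[|[|n]]]] IH //.
rewrite qrecSSSS coefB !coef0M IH // !coefD coef1 coefX coefXn.
by rewrite mul0r subr0 !addr0 mul1r.
Qed.

Lemma qfib_den_coef0 (n : nat) : (qfib_den ('X : {poly int}) n)`_0 = 1.
Proof. by apply: qrec_coef0; rewrite ?coefD ?coef1 ?coefX ?coefXn. Qed.

Lemma qfib_den_neq0 (n : nat) : qfib_den ('X : {poly int}) n != 0.
Proof. by apply: contra_eq_neq (qfib_den_coef0 n) => ->; rewrite coef0. Qed.

(** A digit 3 contributes [3]_q = 1 + q + q^2 and q^2, which are the coefficients of the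
    recurrence. *)
Lemma hj_qvalue_tail (n : nat) :
  hj_qvalue (hj_tail n.+1) =
    tofrac (qfib_den 'X n.+2) / tofrac (qfib_den 'X n).
Proof.
suff [] : hj_qvalue (hj_tail n.+1) =
            tofrac (qfib_den 'X n.+2) / tofrac (qfib_den 'X n) /\
          hj_qvalue (hj_tail n.+2) =
            tofrac (qfib_den 'X n.+3) / tofrac (qfib_den 'X n.+1) by [].
elim: n => [|n [h h1]].
  by rewrite /qfib_den /= -qint3 -qint2 tofrac1 !divr1.
split=> //; rewrite [hj_tail _]/= hj_qvalue_cons ?hj_tail_neq0 // h invf_div.
have f2 : tofrac (qfib_den ('X : {poly int}) n.+2) != 0.
  by rewrite tofrac_eq0 qfib_den_neq0.
apply: (mulIf f2); rewrite mulrBl mulrA !divfK //.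
by rewrite -!tofracM -tofracB qint3.
Qed.

Lemma qrat_fib_ratio (n : nat) :
  qrat (fib_ratio n) = tofrac (qfib_num 'X n) / tofrac (qfib_den 'X n).
Proof.
case: n => [|n].
  rewrite /qrat (_ : hj_expansion _ = [:: 1%N]).
    by rewrite /= /qint big_ord1 expr0 tofrac1 divr1.
  apply: (@hj_expansion_unique (fib_ratio 0)) => //.
  exact/hj_expansionP/fib_ratio_gt0.
rewrite /qrat hj_expansion_fib_ratio; case: n => [|n].
  by rewrite /= qint2 /qfib_num /qfib_den /= tofrac1 divr1.
rewrite hj_qvalue_cons ?hj_tail_neq0 // hj_qvalue_tail invf_div.
have f2 : tofrac (qfib_den ('X : {poly int}) n.+2) != 0.
  by rewrite tofrac_eq0 qfib_den_neq0.
apply: (mulIf f2); rewrite mulrBl mulrA !divfK //.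
by rewrite -!tofracM -tofracB qint2 expr1 qfib_numE.
Qed.

(** The quotient built along the continued fraction is reduced, so by uniqueness it is the chosen
    one and hands over its Bezout relation. *)
Lemma qrat_quotient_bezout (x : rat) : 0 < x ->
  exists a b : {poly int}, exists k : nat,
    [/\ qrat x = tofrac (qnum x) / tofrac (qden x), (qden x)`_0 = 1
      & a * qnum x + b * qden x = 'X^k].
Proof.
move=> x0; have [/hj_qvalue_quotient] := hj_expansionP x0.
move=> [R [S [a [b [k [e S0 ab hR hS]]]]]] _.
have red : is_reduced_quotient (qrat x) (R, S).
  split=> //=; first by apply: contra_eq_neq S0 => ->; rewrite coef0.
  (* A common divisor [d] divides ['X^k]; its constant term is nonzero because [S] has constant term
     1, so [d] divides 1. *)
  move=> d [r er] [s es].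
  have d0 : d`_0 != 0.
    by apply: contra_eq_neq S0 => d0; rewrite es coef0M d0 mulr0.
  have [|u eu] := dvd_Xn_mul (k := k) (p := 1) d0.
    by exists (a * r + b * s); rewrite mulr1 -ab er es; ring.
  by apply/unitrPr; exists u; rewrite mulrC.
have -> : qnum x = R by rewrite /qnum /qrat_quotient
  (qrat_quotient_unique x0 (xgetI (0, 0) red) red).
have -> : qden x = S by rewrite /qden /qrat_quotient
  (qrat_quotient_unique x0 (xgetI (0, 0) red) red).
by exists a, b, k.
Qed.

(* [P] and [Q] need not be coprime: the Bezout relation of the reduced quotient
   does all the work. *)
Lemma qrat_quotient_nonroot (x : rat) (P Q : {poly int}) (F : fieldType)
    (z : F) :
  0 < x -> Q != 0 -> qrat x = tofrac P / tofrac Q ->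
  ~~ root (map_poly intr P) z -> ~~ root (map_poly intr Q) z ->
  ~~ root (map_poly intr (qnum x)) z /\ ~~ root (map_poly intr (qden x)) z.
Proof.
move=> x0 Qn0 ePQ Pz Qz; have [a [b [k [e S0 ab]]]] := qrat_quotient_bezout x0.
have Sn0 : qden x != 0 by apply: contra_eq_neq S0 => ->; rewrite coef0.
have eq1 : qnum x * Q = P * qden x.
  apply/eqP; rewrite -tofrac_eq !tofracM.
  by rewrite -eqr_div ?tofrac_eq0 // -e -ePQ.
have : root (map_poly intr (qnum x)) z = root (map_poly intr (qden x)) z.
  have := congr1 (fun p => root (map_poly intr p) z) eq1.
  by rewrite !rmorphM !rootM (negPf Pz) (negPf Qz) orbF.
case: (boolP (root (map_poly intr (qden x)) z)) => [Sz Rz|Sz ->] //.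
(* A common root gives z^k = 0, hence z = 0, where the denominator is 1. *)
have /eqP := congr1 (fun p => (map_poly intr p).[z]) ab.
rewrite rmorphD !rmorphM /= !hornerE (eqP Sz) (eqP Rz) !mulr0 addr0.
rewrite map_polyXn hornerXn eq_sym expf_eq0 => /andP[_ /eqP z0].
move: Sz; rewrite z0 /root horner_coef0 coef_map /= S0.
by rewrite rmorph1 oner_eq0.
Qed.

(** * Nonvanishing for small and for large |z| *)

#[local] Arguments normc : simpl never.

Section NonVanishing.

Variables (R : rcfType) (z : R[i]).

Lemma normcX (n : nat) : normc (z ^+ n) = normc z ^+ n.
Proof.
by elim: n => [|n IH]; rewrite ?expr0 ?normc1 // !exprS normcM IH.
Qed.

Lemma normc_ge0 (w : R[i]) : 0 <= normc w.
Proof. by case: w => x y; exact: sqrtr_ge0. Qed.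

Lemma normc_gt0 (w : R[i]) : (0 < normc w) = (w != 0).
Proof.
rewrite lt_def normc_ge0 andbT; congr (~~ _).
by apply/eqP/eqP => [/eq0_normc|->] //; rewrite normc0.
Qed.

Lemma le_normcB (v w : R[i]) : normc v - normc w <= normc (v - w).
Proof. by rewrite lerBlDr -{1}(subrK w v) le_normcD. Qed.

Lemma le_normcB_D (v w : R[i]) : normc v - normc w <= normc (v + w).
Proof. by rewrite -(normcN w) -{2}(opprK w) le_normcB. Qed.

Lemma three_term_neq0 (c : R[i]) (s : nat -> R[i]) :
  2 * normc z < normc c ->
  (forall n, s n.+4 = c * s n.+2 - z ^+ 2 * s n) ->
  s 0%N != 0 -> s 1%N != 0 ->
  normc z * normc (s 0%N) < normc (s 2%N) ->
  normc z * normc (s 1%N) < normc (s 3%N) ->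
  forall n, s n != 0.
Proof.
move=> hc hs s0 s1 h0 h1 n.
have zr := normc_ge0 z.
suff [] : s n != 0 /\ normc z * normc (s n) < normc (s n.+2) by [].
elim/ltn_ind: n => -[|[|n]] IH //; have [sn hn] := IH n ltac:(lia).
have p2 : 0 < normc (s n.+2) by apply: le_lt_trans hn; rewrite mulr_ge0 ?normc_ge0.
split; first by rewrite -normc_gt0.
have := le_normcB (c * s n.+2) (z ^+ 2 * s n).
rewrite -hs !normcM -expr2; apply: lt_le_trans.
(* Of the two copies of |z| |s(n+2)| supplied by [hc], one absorbs |z|^2 |s(n)| and the other is the
   bound to propagate. *)
have : normc z * (normc z * normc (s n)) <= normc z * normc (s n.+2).
  by rewrite ler_wpM2l // ltW.
have : 2 * normc z * normc (s n.+2) < normc c * normc (s n.+2).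
  by rewrite ltr_pM2r.
by rewrite expr2; lra.
Qed.

(* With n = |z|^2, x = Re z, the difference of the squares is
   (2 x + (1 + n) / 2)^2 + (3 n^2 - 22 n + 3) / 4. *)
Lemma normc_qint3_gt :
  normc z <= 9 / 25 \/ 25 / 9 <= normc z ->
  2 * normc z < normc (1 + z + z ^+ 2).
Proof.
have sq (w : R[i]) : normc w ^+ 2 = complex.Re w ^+ 2 + complex.Im w ^+ 2.
  by case: w => a b; rewrite sqr_sqrtr // addr_ge0 ?sqr_ge0.
move=> hz; rewrite -(@ltr_pXn2r _ 2) ?nnegrE ?mulr_ge0 ?normc_ge0 //.
rewrite exprMn sq [ltRHS]sq.
(* In |z|^2 the roots are (11 - 4 sqrt 7)/3 > (9/25)^2 and its inverse. *)
have : 0 < 3 * (normc z ^+ 2) ^+ 2 - 22 * normc z ^+ 2 + 3.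
  have := normc_ge0 z; move: (normc z) hz => r [] h h0.
    have : r ^+ 2 <= 81 / 625 by rewrite expr2; nra.
    by nra.
  have : 625 / 81 <= r ^+ 2 by rewrite expr2; nra.
  by nra.
rewrite !sq; case: z => x y /=.
have := sqr_ge0 (2 * x + (1 + (x ^+ 2 + y ^+ 2)) / 2).
by rewrite !expr2 /=; lra.
Qed.

Hypothesis hz : normc z <= 9 / 25 \/ 25 / 9 <= normc z.

Lemma normc_1Dz : `|1 - normc z| <= normc (1 + z).
Proof.
rewrite ler_norml; have := le_normcB_D 1 z; have := le_normcB_D z 1.
by rewrite normc1 (addrC z 1) => h1 h2; apply/andP; split; lra.
Qed.

Lemma one_plus_neq0 : 1 + z != 0.
Proof.
rewrite -normc_gt0; apply: lt_le_trans normc_1Dz.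
by rewrite normr_gt0 subr_eq0; apply/eqP => h; case: hz; lra.
Qed.

Lemma qfib_num_eval_neq0 (n : nat) : qfib_num z n != 0.
Proof.
have h3 := normc_qint3_gt hz; have r0 := normc_ge0 z.
move: n; apply: (three_term_neq0 h3) => //; rewrite /qfib_num /=.
- exact: oner_neq0.
- exact: one_plus_neq0.
- by rewrite normc1; lra.
case: hz => hr.
  have -> : 1 + z + 2 * z ^+ 2 + z ^+ 3 = (1 + z) + z ^+ 2 * (2 + z) by ring.
  apply: lt_le_trans (le_normcB_D _ _); rewrite normcM normcX.
  have h2 : normc (2 + z) <= 2 + normc z.
    apply: le_trans (le_normcD _ _) _.
    by rewrite lerD2r -[2]/(1 *+ 2) normcMn normc1.
  have hm : 1 - normc z <= normc (1 + z).
    exact: le_trans (ler_norm _) normc_1Dz.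
  (* This bound is below (16/25)^2 <= (1 - |z|) |1 + z|. *)
  have : normc z ^+ 2 * normc (2 + z) <= 81 / 625 * (59 / 25).
    apply: ler_pM; rewrite ?sqr_ge0 ?normc_ge0 //; last by lra.
    by rewrite expr2; nra.
  by nra.
have -> : 1 + z + 2 * z ^+ 2 + z ^+ 3 = z * (1 + z) ^+ 2 + 1 by ring.
apply: lt_le_trans (le_normcB_D _ _).
rewrite normc1 expr2 !normcM.
have hm : normc z - 1 <= normc (1 + z).
  by apply: le_trans normc_1Dz; rewrite distrC ler_norm.
move: (normc z) (normc (1 + z)) hr hm => r m hr hm.
(* The goal amounts to r m (m - 1) > 1, with m >= 16/9. *)
have : 25 / 9 * (16 / 9) <= r * m by apply: ler_pM; lra.
by nra.
Qed.

Lemma qfib_den_eval_neq0 (n : nat) : qfib_den z n != 0.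
Proof.
have h3 := normc_qint3_gt hz; have r0 := normc_ge0 z.
case: hz => hr.
  move: n; apply: (three_term_neq0 h3) => //; rewrite /qfib_den /=.
  - exact: oner_neq0.
  - exact: oner_neq0.
  - rewrite normc1 mulr1; apply: lt_le_trans normc_1Dz.
    by apply: lt_le_trans (ler_norm _); lra.
  - by rewrite normc1; lra.
(* For large |z| the initial bound |z| < |1 + z| may fail, so the propagation starts at index 1. *)
case: n => [|n]; first exact: oner_neq0.
move: n; apply: (@three_term_neq0 _ (fun n => qfib_den z n.+1) h3) => //;
  rewrite /qfib_den /=.
- exact: oner_neq0.
- exact: one_plus_neq0.
- by rewrite normc1; lra.
have -> : (1 + z + z ^+ 2) * (1 + z) - z ^+ 2 * 1 =
          z ^+ 2 * (1 + z) + (1 + 2 * z) by ring.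
apply: lt_le_trans (le_normcB_D _ _).
have h2 : normc (1 + 2 * z) <= 1 + 2 * normc z.
  apply: le_trans (le_normcD _ _) _.
  by rewrite normcM normc1 -[2]/(1 *+ 2) normcMn normc1.
have hm : normc z - 1 <= normc (1 + z).
  by apply: le_trans normc_1Dz; rewrite distrC ler_norm.
rewrite normcM normcX expr2.
move: (normc z) (normc (1 + z)) (normc (1 + 2 * z)) hr hm h2 => r m t hr hm h2.
(* The goal reduces to r (r - 1) m > 1 + 2 r, where m >= r - 1. *)
have : 25 / 9 * (16 / 9) <= r * (r - 1) by apply: ler_pM; lra.
have : (r * (r - 1)) * (r - 1) <= (r * (r - 1)) * m.
  by rewrite ler_wpM2l // mulr_ge0; lra.
by nra.
Qed.

Lemma fib_ratio_nonroot (n : nat) :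
  ~~ root (map_poly intr (qnum (fib_ratio n))) z /\
  ~~ root (map_poly intr (qden (fib_ratio n))) z.
Proof.
apply: (@qrat_quotient_nonroot _ (qfib_num 'X n) (qfib_den 'X n)).
- exact: fib_ratio_gt0.
- exact: qfib_den_neq0.
- exact: qrat_fib_ratio.
(* Coefficient change and evaluation at [z] are ring morphisms, so they carry the sequence at ['X]
   to the one at [z]. *)
- rewrite rootE rmorph_qfib_num /= map_polyX -[_.[z]]/(horner_eval z _).
  by rewrite rmorph_qfib_num /= /horner_eval hornerX qfib_num_eval_neq0.
- rewrite rootE rmorph_qfib_den /= map_polyX -[_.[z]]/(horner_eval z _).
  by rewrite rmorph_qfib_den /= /horner_eval hornerX qfib_den_eval_neq0.
Qed.

End NonVanishing.

Theorem theorem3p1 (R : realType) (R0 : R) (R0_gt0 : 0 < R0)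
    (R0_root : R0 ^+ 3 + 2 * R0 ^+ 2 + 2 * R0 - 1 = 0)
    (n : nat) (n_ge1 : (1 <= n)%N) (z : R[i]) :
  root (map_poly intr (fib_poly n)) z \/
  root (map_poly intr (fib_poly_tilde n)) z ->
  R0%:C < `|z| < (R0^-1)%:C.
Proof.
move=> hroot; have nE : `|z| = (normc z)%:C by [].
have [hz|hz] := pselect (normc z <= 9 / 25 \/ 25 / 9 <= normc z).
  have [_ h1] := fib_ratio_nonroot hz n.
  have [h2 _] := fib_ratio_nonroot hz n.-1.
  by case: hroot => h; [rewrite h in h1|rewrite h in h2].
(* The cubic increases on positive reals and is positive at 9/25. Hence the region left by the
   nonvanishing lies inside the annulus. *)
have R0lt : R0 < 9 / 25.
  rewrite ltNge; apply/negP => h.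
  have : 81 / 625 <= R0 ^+ 2 by rewrite expr2; nra.
  have : 729 / 15625 <= R0 ^+ 3 by rewrite exprS expr2; nra.
  by nra.
rewrite nE !ltcR; apply/andP; split.
  by rewrite ltNge; apply/negP => h; apply: hz; left; lra.
rewrite ltNge; apply/negP => h; apply: hz; right; apply: le_trans h.
by rewrite -invf_div lef_pV2 ?posrE ?ltW //; lra.
Qed.
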